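(* Let $(R,\mathfrak m)\rightarrow (S,\mathfrak n)$ be a local homomorphism of commutative Noetherian local rings with identity such that $S$ is a finitely generated $R$-module. Then every weakly Laskerian $S$-module, regarded as an $R$-module via $R\to S$, is a weakly Laskerian $R$-module.
   Context: For a commutative ring $A$, an $A$-module $M$ is called weakly Laskerian if the set of associated primes $\mathrm{Ass}_A(M/N)$ is finite for each proper $A$-submodule $N$ of $M$. All modules are unitary. *)

(* Defs.v *)
From HB Require Import structures.
From mathcomp Require Import all_boot all_algebra.
From mathcomp Require Import generic_quotient ring_quotient.
From mathcomp Require Import boolp classical_sets cardinality.

Set Implicit Arguments.
Unset Strict Implicit.
Unset Printing Implicit Defensive.

Import GRing.Theory.
Local Open Scope ring_scope.
Local Open Scope quotient_scope.

(* Ideals and submodules are boolean predicates, as in ssralg and ring_quotient.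
   With the classical axioms of boolp every subset is given by such a predicate,
   and extensionally equal predicates are equal. *)

Definition restr_scalars (R S : comNzRingType) (phi : {rmorphism R -> S})
  (M : lmodType S) : Type := M.

Section RestrictionOfScalars.
Variables (R S : comNzRingType) (phi : {rmorphism R -> S}) (M : lmodType S).

Local Notation M' := (restr_scalars phi M).

HB.instance Definition _ := GRing.Zmodule.on M'.

Definition restr_scale (a : R) (x : M') : M' := phi a *: (x : M).

Fact restr_scaleA a b x :
  restr_scale a (restr_scale b x) = restr_scale (a * b) x.
Proof. by rewrite /restr_scale rmorphM scalerA. Qed.

Fact restr_scale1 : left_id 1 restr_scale.
Proof. by move=> x; rewrite /restr_scale rmorph1 scale1r. Qed.

Fact restr_scaleDr : right_distributive restr_scale +%R.
Proof. by move=> a x y; rewrite /restr_scale scalerDr. Qed.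

Fact restr_scaleDl x : {morph restr_scale^~ x : a b / a + b}.
Proof. by move=> a b; rewrite /restr_scale rmorphD scalerDl. Qed.

HB.instance Definition _ := GRing.Zmodule_isLmodule.Build R M'
  restr_scaleA restr_scale1 restr_scaleDr restr_scaleDl.

End RestrictionOfScalars.

Section QuotientModule.
Variables (R : comNzRingType) (M : lmodType R) (N : submodClosed M).

(* submodClosed does not mention opposites, which scaling by -1 provides. *)
Definition submod_pred : {pred M} := N.

Fact submod_pred_zmod_closed : zmod_closed submod_pred.
Proof. exact: GRing.submod_closedB (submodClosedP N). Qed.

HB.instance Definition _ := GRing.isZmodClosed.Build M submod_pred
  submod_pred_zmod_closed.

Definition quotmod : Type := Quotient.quot submod_pred.

HB.instance Definition _ := GRing.Zmodule.on quotmod.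

Definition quotmod_pi (x : M) : quotmod := \pi_(Quotient.quot submod_pred) x.

Lemma quotmodW (P : quotmod -> Prop) :
  (forall x, P (quotmod_pi x)) -> forall q, P q.
Proof. by move=> Ppi q; rewrite -[q](@reprK _ (Quotient.quot submod_pred)). Qed.

Lemma quotmod_piD x y : quotmod_pi (x + y) = quotmod_pi x + quotmod_pi y.
Proof. exact: (raddfD \pi_(Quotient.quot submod_pred)). Qed.

Lemma quotmod_pi_eq x y : (quotmod_pi x == quotmod_pi y) = (x - y \in N).
Proof. by rewrite /quotmod_pi -Quotient.idealrBE. Qed.

Definition quotmod_scale (a : R) (q : quotmod) : quotmod :=
  quotmod_pi (a *: repr (q : Quotient.quot submod_pred)).

Lemma quotmod_scale_pi a x :
  quotmod_scale a (quotmod_pi x) = quotmod_pi (a *: x).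
Proof.
apply/eqP; rewrite quotmod_pi_eq -scalerBr; apply: (@rpredZ _ _ N).
by rewrite -quotmod_pi_eq /quotmod_pi reprK.
Qed.

Fact quotmod_scaleA a b q :
  quotmod_scale a (quotmod_scale b q) = quotmod_scale (a * b) q.
Proof. by elim/quotmodW: q => x; rewrite !quotmod_scale_pi scalerA. Qed.

Fact quotmod_scale1 : left_id 1 quotmod_scale.
Proof. by elim/quotmodW=> x; rewrite quotmod_scale_pi scale1r. Qed.

Fact quotmod_scaleDr : right_distributive quotmod_scale +%R.
Proof.
move=> a; elim/quotmodW=> x; elim/quotmodW=> y.
by rewrite -quotmod_piD !quotmod_scale_pi scalerDr quotmod_piD.
Qed.

Fact quotmod_scaleDl q : {morph quotmod_scale^~ q : a b / a + b}.
Proof.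
by elim/quotmodW: q => x a b; rewrite !quotmod_scale_pi scalerDl quotmod_piD.
Qed.

HB.instance Definition _ := GRing.Zmodule_isLmodule.Build R quotmod
  quotmod_scaleA quotmod_scale1 quotmod_scaleDr quotmod_scaleDl.

End QuotientModule.

Definition finitely_generated (R : comNzRingType) (M : lmodType R) : Prop :=
  exists (k : nat) (g : 'I_k -> M),
    forall x : M, exists c : 'I_k -> R, x = \sum_(i < k) c i *: g i.

(* The ideals of R are the submodules of the regular module R^o. *)
Definition noetherian (R : comNzRingType) : Prop :=
  forall I : submodClosed R^o, exists (k : nat) (g : 'I_k -> R),
    forall x : R, x \in I <-> exists c : 'I_k -> R, x = \sum_(i < k) c i * g i.

(* idealr_closed includes properness (1 \notin I). *)
Definition maximal_ideal (R : comNzRingType) (m : pred R) : Prop :=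
  idealr_closed m /\
  forall J : pred R, idealr_closed J -> {subset m <= J} -> J =i m.

Definition local_ring (R : comNzRingType) (m : pred R) : Prop :=
  maximal_ideal m /\ forall m' : pred R, maximal_ideal m' -> m' =i m.

Definition local_hom (R S : comNzRingType) (m : pred R) (n : pred S)
    (phi : {rmorphism R -> S}) : Prop :=
  forall a : R, a \in m -> phi a \in n.

Definition prime_ideal (R : comNzRingType) (P : pred R) : Prop :=
  idealr_closed P /\ prime_idealr_closed P.

Definition annihilator (R : comNzRingType) (M : lmodType R) (x : M) : pred R :=
  [pred a : R | a *: x == 0].

Definition Ass (R : comNzRingType) (M : lmodType R) : set (pred R) :=
  [set P : pred R | prime_ideal P /\ exists x : M, P =i annihilator x]%classic.

Definition weakly_laskerian (R : comNzRingType) (M : lmodType R) : Prop :=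
  forall N : submodClosed M, (exists x : M, x \notin N) ->
    finite_set (Ass (quotmod N)).

(* Main.v *)
(* Suppose that an R-submodule N of M has Ass_R(M/N) infinite.  Enlarging N by
   one element keeps Ass_R(M/N) infinite (ACC on ideals of R), hence so does
   enlarging it by a finitely generated S-submodule L, which is finitely
   generated over R.  Each p in Ass_R(M/(N+L)) contains the contraction of some
   Ann_S(x), x in M/L, so by lying over it is the contraction of a prime in
   Supp_S(M/L).  Therefore Supp_S(M/L) is infinite for every finitely generated
   S-submodule L.

   From this one builds an S-submodule K with Ass_S(M/K) infinite.  Let I be
   maximal among the ideals such that V(I) meets every Supp(M/L) in an infinite
   set.  By maximality, one can choose inductively primes q_0, q_1, ... strictly
   above I, each containing none of the previous ones, with q_n in Supp(M/L_n)
   for a large L_n, and elements y_n such that K = sum q_n y_n satisfies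
   (K : y_n) = q_n. *)

Require Import Defs.
From HB Require Import structures.
From mathcomp Require Import all_boot all_algebra.
From mathcomp Require Import generic_quotient ring_quotient.
From mathcomp Require Import boolp classical_sets cardinality.

Set Implicit Arguments.
Unset Strict Implicit.
Unset Printing Implicit Defensive.

Import GRing.Theory.
Local Open Scope ring_scope.
Local Open Scope classical_set_scope.

(** * Submodules, ideals and colon ideals as sets *)

Definition submodule (R : comNzRingType) (M : lmodType R) (N : set M) : Prop :=
  N 0 /\ forall a x y, N x -> N y -> N (a *: x + y).

Definition ideal (R : comNzRingType) (I : set R) : Prop :=
  I 0 /\ forall a x y, I x -> I y -> I (a * x + y).

Definition colon (R : comNzRingType) (M : lmodType R) (N : set M) (x : M) :
  set R := [set r | N (r *: x)].

(** The associated primes of [M / N], phrased inside [M] so that [N] can vary without forming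
    quotients. *)
Definition Ass_over (R : comNzRingType) (M : lmodType R) (N : set M) :
    set (pred R) :=
  [set P | prime_ideal P /\ exists x, forall r, r \in P <-> N (r *: x)].

Section Submodules.
Variables (R : comNzRingType) (M : lmodType R).
Implicit Types (N : set M) (x y : M) (a b : R).

Lemma submoduleD N x y : submodule N -> N x -> N y -> N (x + y).
Proof. by move=> [_ sN] Nx Ny; rewrite -[x]scale1r; apply: sN. Qed.

Lemma submoduleZ N a x : submodule N -> N x -> N (a *: x).
Proof. by move=> [N0 sN] Nx; rewrite -[_ *: _]addr0; apply: sN. Qed.

Lemma submoduleB N x y : submodule N -> N x -> N y -> N (x - y).
Proof.
by move=> sN Nx Ny; apply: submoduleD => //; rewrite -scaleN1r;
   apply: submoduleZ.
Qed.

Lemma submodule_sum N (I : Type) (r : seq I) (F : I -> M) :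
  submodule N -> (forall i, N (F i)) -> N (\sum_(i <- r) F i).
Proof.
move=> sN NF; elim/big_rec: _ => [|i x _ Nx]; first by case: sN.
exact: submoduleD.
Qed.

Lemma ideal_colon N x : submodule N -> ideal (colon N x).
Proof.
move=> sN; split=> [|a r s Nr Ns]; rewrite /colon /=.
  by rewrite scale0r; case: sN.
by rewrite scalerDl -scalerA; apply: submoduleD => //; apply: submoduleZ.
Qed.

Definition add_line N (I : set R) x : set M :=
  [set z | exists w a, [/\ N w, I a & z = w + a *: x]].

Lemma submodule_add_line N I x :
  submodule N -> ideal I -> submodule (add_line N I x).
Proof.
move=> sN [I0 sI]; split=> [|a _ _ [u [b [Nu Ib ->]]] [v [c [Nv Ic ->]]]].
  by exists 0, 0; split; rewrite ?scale0r ?addr0 //; case: sN.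
exists (a *: u + v), (a * b + c); split; [|exact: sI|].
  by case: sN => _; apply.
by rewrite scalerDr scalerDl scalerA addrACA.
Qed.

Lemma add_lineI N I x a w : N w -> I a -> add_line N I x (w + a *: x).
Proof. by move=> Nw Ia; exists w, a. Qed.

Lemma sub_add_line N I x : ideal I -> N `<=` add_line N I x.
Proof.
by move=> [I0 _] w Nw; rewrite -[w]addr0 -(scale0r x); apply: add_lineI.
Qed.

End Submodules.

(** * Prime ideals and the maximal condition *)

Section Ideals.
Variable R : comNzRingType.
Implicit Types (I : set R) (P : pred R).

Lemma ideal_submodule I : ideal I -> submodule (I : set R^o).
Proof. by []. Qed.

Lemma idealT : ideal [set: R]. Proof. by []. Qed.

Lemma idealMl I a x : ideal I -> I x -> I (a * x).
Proof. by move=> /ideal_submodule sI; apply: (submoduleZ a sI). Qed.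

Lemma prime_is_ideal P : prime_ideal P -> ideal [set` P].
Proof.
by move=> [[P0 _ sP] _]; split=> // a x y; rewrite /=; apply: sP.
Qed.

Lemma prime_ideal1 P : prime_ideal P -> 1 \notin P.
Proof. by move=> [[]]. Qed.

Lemma prime_idealM P a b :
  prime_ideal P -> a * b \in P -> (a \in P) || (b \in P).
Proof. by move=> [_]; apply. Qed.

Lemma prime_idealX P a k : prime_ideal P -> a ^+ k \in P -> a \in P.
Proof.
move=> pP; elim: k => [|k IHk].
  by rewrite expr0 (negPf (prime_ideal1 pP)).
by rewrite exprS => /(prime_idealM pP)/orP[].
Qed.

(** Otherwise choice yields a strictly ascending chain in [F]; its union is a finitely generated
    ideal, and one member already contains all the generators. *)
Lemma noetherian_maximal (F : set R -> Prop) I0 : noetherian R -> F I0 ->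
    (forall I, F I -> ideal I) ->
  exists2 I, F I & forall J, F J -> I `<=` J -> J `<=` I.
Proof.
move=> noeR FI0 idF; apply: contrapT => noMax.
have /choice[next nextP] : forall I, exists J,
    F I -> [/\ F J, I `<=` J & ~ J `<=` I].
  move=> I; case: (pselect (F I)) => [FI|]; last by exists I.
  apply: contrapT => noJ; apply: noMax; exists I => // J FJ IJ.
  by apply: contrapT => nJI; apply: noJ; exists J.
pose I n := iter n next I0.
have FI n : F (I n) by elim: n => //= n /nextP[].
have nI n : [/\ F (I n.+1), I n `<=` I n.+1 & ~ I n.+1 `<=` I n].
  exact: nextP (FI n).
have leI m n : (m <= n)%N -> I m `<=` I n.
  move=> /subnK <-; elim: (n - m)%N => //= k IHk.
  by case: (nI (k + m)%N) => _ /(subset_trans IHk).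
pose U : pred R^o := [pred x | `[< exists n, I n x >]].
have UP x : x \in U <-> exists n, I n x.
  by split=> [/asboolP|?]//; apply/asboolP.
have sU : GRing.subsemimod_closed U.
  split; first split.
  - by apply/UP; exists 0%N; case: (idF _ FI0).
  - move=> x y /UP[j Ijx] /UP[k Iky]; apply/UP; exists (maxn j k).
    have sI := ideal_submodule (idF _ (FI (maxn j k))).
    apply: (submoduleD sI); first exact: leI (leq_maxl j k) _ Ijx.
    exact: leI (leq_maxr j k) _ Iky.
  - move=> a x /UP[j Ijx]; apply/UP; exists j.
    exact: (submoduleZ a (ideal_submodule (idF _ (FI j)))).
pose UM := GRing.isSubmodClosed.Build R R^o U sU.
pose UC : submodClosed R^o := HB.pack U UM.
have [k [g gP]] := noeR UC.
have /choice[d dP] : forall i, exists n, I n (g i).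
  move=> i; apply/UP/gP; exists (fun j => (j == i)%:R).
  rewrite (bigD1 i) //= eqxx mul1r big1 ?addr0 // => j /negPf ->.
  by rewrite mul0r.
pose n := (\max_i d i)%N.
have [_ _] := nI n; apply=> x Ix.
have /gP[c ->] : x \in U by apply/UP; exists n.+1.
have sI := ideal_submodule (idF _ (FI n)).
apply: (submodule_sum _ sI) => i; apply: (submoduleZ (c i) sI).
by apply: leI (dP i); apply: leq_bigmax.
Qed.

End Ideals.

(** * Associated primes when a submodule is enlarged *)

Section AssociatedPrimes.
Variables (R : comNzRingType) (M : lmodType R).
Implicit Types (N : set M) (x y z : M) (p q : pred R).

Lemma Ass_quotmod (N : submodClosed M) : Ass (quotmod N) = Ass_over [set` N].
Proof.
have scaleq a x : (a *: quotmod_pi N x == 0) = (a *: x \in N).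
  have <- : quotmod_pi N 0 = 0.
    by rewrite -[RHS](scale0r (quotmod_pi N 0)) [RHS]quotmod_scale_pi scale0r.
  by rewrite [_ *: _](quotmod_scale_pi N) quotmod_pi_eq subr0.
apply/seteqP; split=> P [pP [x Px]]; split=> //.
  move: x Px; elim/quotmodW=> x Px; exists x => r.
  by rewrite Px inE scaleq.
exists (quotmod_pi N x) => r; rewrite inE scaleq.
by apply/idP/idP => /Px.
Qed.

(** If [q = (N : x)] is lost, some [r] outside [q] gives [r x = w + s y] with [w] in [N]; primality
    of [q] yields [(N : s y) = (N : r x) = q]. *)
Lemma Ass_over_add_line N (I : set R) y q : submodule N -> ideal I ->
    Ass_over N q -> ~ Ass_over (add_line N I y) q ->
  exists2 s, I s & forall r, r \in q <-> N (r *: (s *: y)).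
Proof.
move=> sN iI [pq [x qx]] Nq.
have [r [rNq [w [s [Nw Is rx]]]]] :
    exists r, r \notin q /\ add_line N I y (r *: x).
  apply: contrapT => noq; apply: Nq; split=> //; exists x => r; split.
    by move=> /qx; apply: sub_add_line.
  by move=> Lr; apply: contrapT => /negP rq; apply: noq; exists r.
exists s => // t; have -> : s *: y = r *: x - w by rewrite rx addrC addKr.
rewrite scalerBr scalerA; split=> [tq|Ntr].
  apply: (submoduleB sN); last exact: submoduleZ.
  by apply/qx; rewrite mulrC; apply: (idealMl r (prime_is_ideal pq)).
have /qx/(prime_idealM pq) : N ((t * r) *: x).
  rewrite -[X in N X](subrK (t *: w)); apply: submoduleD => //.
  exact: submoduleZ.
by rewrite (negPf rNq) orbF.
Qed.

(** Modulo [N] the line [R z] is [R / p], whose nonzero elements all have annihilator [p]; a lost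
    prime is the annihilator of such an element. *)
Lemma Ass_over_add_line_prime N z p : submodule N -> prime_ideal p ->
    (forall r, r \in p <-> N (r *: z)) ->
  Ass_over N `<=` [set p] `|` Ass_over (add_line N setT z).
Proof.
move=> sN pp pz q qN; case: (pselect (Ass_over (add_line N setT z) q)).
  by right.
move=> /(Ass_over_add_line sN (@idealT R) qN)[s _ qs]; left.
have pq : prime_ideal q by case: qN.
have sNp : s \notin p.
  apply: contra (prime_ideal1 pq) => /pz Nsz.
  by apply/qs; rewrite scale1r.
apply/funext => r; apply/idP/idP => [/qs|rp].
  by rewrite scalerA => /pz/(prime_idealM pp); rewrite (negPf sNp) orbF.
by apply/qs; rewrite scalerA; apply/pz; rewrite mulrC;
   apply: (idealMl s (prime_is_ideal pp)).
Qed.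

(** Otherwise take [J] maximal with [Ass_over (N + J x)] infinite. A lost prime has the form
    [(N + J x : s x)]. Adjoining [s x] loses at most this prime, so maximality puts [s] in [J], and
    the prime would contain 1. *)
Lemma infinite_Ass_over_add_line N x : noetherian R -> submodule N ->
  infinite_set (Ass_over N) -> infinite_set (Ass_over (add_line N setT x)).
Proof.
move=> noeR sN infN finNx.
pose F (J : set R) := ideal J /\ infinite_set (Ass_over (add_line N J x)).
have id0 : ideal [set (0 : R)].
  by split=> // a _ _ -> ->; rewrite /= mulr0 addr0.
have F0 : F [set 0].
  split=> //; suff -> : add_line N [set 0] x = N by [].
  apply/seteqP; split; last exact: sub_add_line.
  by move=> _ [w [_ [Nw -> ->]]]; rewrite scale0r addr0.
have [J [iJ infJ] maxJ] := noetherian_maximal noeR F0 (fun J => @proj1 _ _).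
set K := add_line N J x in infJ.
have sK : submodule K by apply: submodule_add_line.
have KT : add_line K setT x = add_line N setT x.
  apply/seteqP; split=> [_ [_ [a [[w [b [Nw _ ->]]] _ ->]]]|].
    by rewrite -addrA -scalerDl; apply: add_lineI.
  by move=> _ [w [a [Nw _ ->]]]; apply: add_lineI => //; apply: sub_add_line.
have [q [qK qNx]] := infinite_setN0 (infinite_setD infJ finNx).
have [pq _] := qK.
rewrite -KT in qNx.
have [s _ qs] := Ass_over_add_line sK (@idealT R) qK qNx.
pose J' := add_line (J : set R^o) setT (s : R^o).
have iJ' : ideal J'.
  by apply: (@submodule_add_line R R^o) => //; apply: ideal_submodule.
have KJ' : add_line K setT (s *: x) = add_line N J' x.
  apply/seteqP; split=> [_ [_ [a [[w [b [Nw Jb ->]]] _ ->]]]|].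
    rewrite -addrA scalerA -scalerDl; apply: add_lineI => //.
    exact: (@add_lineI R R^o).
  move=> _ [w [_ [Nw [b [a [Jb _ ->]]] ->]]].
  rewrite scalerDl -scalerA addrA; apply: add_lineI => //.
  exact: add_lineI.
have J's : J' s.
  exists 0, 1; split=> //; first by case: iJ.
  by rewrite add0r scale1r.
have Js : J s.
  apply: (maxJ J') J's; last exact: (@sub_add_line R R^o).
  split=> //; rewrite -KJ'; apply: contra_not infJ => finK.
  apply: sub_finite_set (Ass_over_add_line_prime sK pq qs) _.
  by rewrite finite_setU.
move/negP: (prime_ideal1 pq); apply; apply/qs.
rewrite scale1r -[_ *: x]add0r; apply: add_lineI => //.
by case: sN.
Qed.

End AssociatedPrimes.

(** * The determinant trick and lying over *)

Lemma det_congr_ideal (R : comNzRingType) (P : set R) (k : nat)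
    (A B : 'M[R]_k) :
  ideal P -> (forall i j, P (A i j - B i j)) -> P (\det A - \det B).
Proof.
move=> iP AB; have sP := ideal_submodule iP.
have P0 : P 0 by case: iP.
rewrite /determinant -sumrB; apply: (submodule_sum _ sP) => s.
rewrite -mulrBr; apply: idealMl => //.
elim/big_ind2: _ => [|b a d c Pab Pcd|i _]; rewrite ?subrr //.
have -> : a * c - b * d = a * (c - d) + d * (a - b).
  by rewrite !mulrBr [d * a]mulrC [d * b]mulrC addrA subrK.
by apply: (submoduleD sP); apply: idealMl.
Qed.

Section LyingOver.
Variables (R S : comNzRingType) (phi : {rmorphism R -> S}).

(* The determinant trick: modulo [q], multiplication by [b s = t] is given on
   the generators of [S] by a matrix with entries in [b R]. *)
Lemma finite_contraction (q : set S) (p : pred R) (s : S) (t b : R) :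
    finitely_generated (restr_scalars phi S^o) -> ideal q -> prime_ideal p ->
    (forall r, q (phi r) -> r \in p) -> q (phi t - s * phi b) -> b \in p ->
  t \in p.
Proof.
move=> [k [g gP]] iq pp qp qtsb bp; have sq := ideal_submodule iq.
have ip := prime_is_ideal pp.
have /choice[c cP] : forall i, exists c : 'I_k -> R,
    s * g i = \sum_(j < k) phi (c j) * g j.
  by move=> i; have [c ->] := gP (s * g i); exists c.
pose A := t%:M - b *: \matrix_(i, j) c i j.
pose G : 'cV[S]_k := \col_i g i.
have qAG i : q ((map_mx phi A *m G) i 0).
  have -> : (map_mx phi A *m G) i 0 = (phi t - s * phi b) * g i.
    rewrite mulrBl mulrAC cP mulr_suml mxE.
    have -> : phi t * g i = \sum_(j < k) phi (t *+ (i == j)) * g j.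
      rewrite (bigD1 i) //= eqxx big1 ?addr0 // => j /negPf.
      by rewrite eq_sym => ->; rewrite mulr0n rmorph0 mul0r.
    rewrite -sumrB; apply: eq_bigr => j _; rewrite !mxE rmorphB rmorphM mulrBl.
    by rewrite [phi b * _]mulrC mulrAC.
  by rewrite mulrC; apply: idealMl.
(* The adjugate shows that [\det A] kills every generator modulo [q], hence also 1. *)
have qdet i : q (phi (\det A) * g i).
  have -> : phi (\det A) * g i =
      (\adj (map_mx phi A) *m (map_mx phi A *m G)) i 0.
    by rewrite mulmxA mul_adj_mx mul_scalar_mx -det_map_mx !mxE.
  by rewrite mxE; apply: (submodule_sum _ sq) => j; apply: idealMl.
have detA : \det A \in p.
  apply: qp; have [d d1] := gP 1.
  have {}d1 : 1 = \sum_(i < k) phi (d i) * g i by exact: d1.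
  rewrite -[phi _]mulr1 d1 mulr_sumr; apply: (submodule_sum _ sq) => i.
  by rewrite mulrCA; apply: idealMl.
(* As [b] is in [p], [A] is congruent to the scalar matrix [t] modulo [p], so [\det A] is congruent
   to [t ^ k]. *)
have detAt : \det A - \det (t%:M : 'M_k) \in p.
  apply: (det_congr_ideal ip) => i j; rewrite !mxE [_ - b * _]addrC addrK.
  rewrite -mulNr mulrC; apply: (idealMl _ ip).
  by rewrite -mulN1r; apply: idealMl.
apply: (@prime_idealX _ _ _ k pp).
rewrite -det_scalar -[\det _](subKr (\det A)).
exact: (submoduleB (ideal_submodule ip)).
Qed.

(** The prime is an ideal [Q] maximal among those containing [I] and contracting into [p]: for [x]
    outside [Q], the ideal [Q + S x] contains some [phi t] with [t] outside [p]. *)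
Lemma lying_over (I : set S) (p : pred R) : noetherian S ->
    finitely_generated (restr_scalars phi S^o) -> ideal I -> prime_ideal p ->
    (forall r, I (phi r) -> r \in p) ->
  exists q : pred S,
    [/\ prime_ideal q, I `<=` [set` q] & forall r, phi r \in q <-> r \in p].
Proof.
move=> noeS fgS iI pp Ip.
pose F (J : set S) :=
  [/\ ideal J, I `<=` J & forall r, J (phi r) -> r \in p].
have FI : F I by split.
have iF J : F J -> ideal J by case.
have [Q [iQ IQ Qp] maxQ] := noetherian_maximal noeS FI iF.
have sQ := ideal_submodule iQ.
have escape x : ~ Q x -> exists t w a, [/\ t \notin p, Q w & phi t = w + a * x].
  move=> nQx; apply: contrapT => noT; apply: nQx.
  pose J := add_line (Q : set S^o) setT (x : S^o).
  have QJ : Q `<=` J by apply: (@sub_add_line S S^o).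
  apply: (maxQ J) => //.
    split; first exact: (@submodule_add_line S S^o).
      exact: subset_trans QJ.
    move=> r [w [a [Qw _ rwx]]]; apply: contrapT => /negP rp.
    by apply: noT; exists r, w, a.
  exists 0, 1; split=> //; first by case: iQ.
  by rewrite add0r scale1r.
exists [pred x | `[< Q x >]].
have QE x : (x \in [pred x | `[< Q x >]]) = `[< Q x >] by [].
split=> [|x Qx|r]; last 1 first.
- rewrite QE; split=> [/asboolP/Qp//|rp]; apply/asboolP.
  (* Otherwise some [phi t] with [t] outside [p] is a multiple of [phi r] modulo [Q], and the
     determinant trick with [b = r] puts [t] in [p]. *)
  apply: contrapT => /escape[t [w [a [tp Qw tE]]]].
  apply/(negP tp)/(finite_contraction fgS iQ pp Qp (s := a) _ rp).
  by rewrite tE addrK.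
- split; first split.
  + by apply/asboolP; case: iQ.
  + apply/negP => /asboolP; rewrite -(rmorph1 phi) => /Qp.
    by rewrite (negPf (prime_ideal1 pp)).
  + move=> a x y /asboolP Qx /asboolP Qy; apply/asboolP.
    by case: iQ => _; apply.
- move=> x y /asboolP Qxy; rewrite !QE; apply/orP; apply: contrapT => nQ.
  have [t [w [a [tp Qw tE]]]] : exists t w a,
      [/\ t \notin p, Q w & phi t = w + a * x].
    by apply: escape => Qx; apply: nQ; left; apply/asboolP.
  have [t' [w' [a' [tp' Qw' tE']]]] : exists t w a,
      [/\ t \notin p, Q w & phi t = w + a * y].
    by apply: escape => Qy; apply: nQ; right; apply/asboolP.
  have /Qp/(prime_idealM pp) : Q (phi (t * t')).
    rewrite rmorphM tE tE' mulrDl mulrC; apply: (submoduleD sQ).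
      exact: idealMl.
    rewrite mulrDr; apply: (submoduleD sQ); first exact: idealMl.
    by rewrite mulrACA; apply: idealMl.
  by rewrite (negPf tp) (negPf tp').
by apply/asboolP/IQ.
Qed.

End LyingOver.

(** * Finite sums of ideals times elements *)

Section WeightedSpans.
Variables (R : comNzRingType) (M : lmodType R).
Implicit Types (l : seq (pred R * M)) (s : seq M) (N : set M).

Fixpoint wspan l : set M :=
  if l is z :: l' then add_line (wspan l') [set` z.1] z.2 else [set 0].

Definition ideal_weights l := forall z, z \in l -> ideal [set` z.1].

Definition span s : set M := wspan [seq (xpredT, y) | y <- s].

Lemma ideal_weights_cons z l :
  ideal_weights (z :: l) -> ideal [set` z.1] /\ ideal_weights l.
Proof.
move=> il; split=> [|u ul]; apply: il; first exact: mem_head.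
by rewrite inE ul orbT.
Qed.

Lemma submodule_wspan l : ideal_weights l -> submodule (wspan l).
Proof.
elim: l => [_|z l IHl /ideal_weights_cons[iz /IHl sl]] /=.
  by split=> // a _ _ -> ->; rewrite /= scaler0 addr0.
exact: submodule_add_line.
Qed.

Lemma wspan_mem l z a : ideal_weights l -> z \in l -> a \in z.1 ->
  wspan l (a *: z.2).
Proof.
elim: l => // u l IHl /ideal_weights_cons[iu il].
rewrite inE => /orP[/eqP <- az /=|zl az /=]; last first.
  by apply: sub_add_line => //; apply: IHl.
rewrite -[_ *: _]add0r; apply: add_lineI => //.
by case: (submodule_wspan il).
Qed.

Lemma wspan_sub l N : submodule N ->
    (forall z, z \in l -> forall a, a \in z.1 -> N (a *: z.2)) ->
  wspan l `<=` N.
Proof.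
move=> sN; elim: l => [_ _ ->|z l IHl lN _ [w [a [lw za ->]]]].
  by case: sN.
apply: (submoduleD sN); last by apply: (lN z); rewrite ?mem_head.
by apply: IHl lw => u ul; apply: lN; rewrite inE ul orbT.
Qed.

Lemma ideal_weights_span s : ideal_weights [seq (xpredT, y) | y <- s].
Proof. by move=> z /mapP[y _ ->]. Qed.

Lemma submodule_span s : submodule (span s).
Proof. exact/submodule_wspan/ideal_weights_span. Qed.

Lemma span_mem s y : y \in s -> span s y.
Proof.
move=> ys; rewrite -[y]scale1r.
apply: (@wspan_mem _ (xpredT, y)) => //; first exact: ideal_weights_span.
exact: map_f.
Qed.

Lemma span_sub s N : submodule N -> (forall y, y \in s -> N y) ->
  span s `<=` N.
Proof.
move=> sN Ns; apply: wspan_sub => // z /mapP[y ys ->] a _ /=.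
by apply: submoduleZ => //; apply: Ns.
Qed.

End WeightedSpans.

(** * Construction of a submodule with infinitely many associated primes *)

Section InfiniteAss.
Variables (R : comNzRingType) (M : lmodType R).
Implicit Types (l : seq (pred R * M)) (s : seq M) (N : set M) (z : pred R * M).

(** The support of [M / N]: the class of [x] survives localisation at [q] exactly when [q] contains
    [(N : x)]. *)
Definition supp_over N : set (pred R) :=
  [set q | prime_ideal q /\ exists x, colon N x `<=` [set` q]].

Lemma prime_avoid l (q : pred R) : prime_ideal q -> ideal_weights l ->
    (forall z, z \in l -> ~ [set` z.1] `<=` [set` q]) ->
  exists2 a, a \notin q & forall z, z \in l -> a \in z.1.
Proof.
move=> pq; elim: l => [_ _|z l IHl /ideal_weights_cons[iz il] nq].
  by exists 1; rewrite ?prime_ideal1.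
have [|a aq al] := IHl il.
  by move=> u ul; apply: nq; rewrite inE ul orbT.
have [b bz bq] : exists2 b, b \in z.1 & b \notin q.
  apply: contrapT => nb; apply: (nq z (mem_head _ _)) => b bz.
  by apply: contrapT => /negP bq; apply: nb; exists b.
exists (a * b).
  by apply/negP => /(prime_idealM pq); rewrite (negPf aq) (negPf bq).
move=> u; rewrite inE => /orP[/eqP ->|ul]; first exact: (idealMl a iz).
by rewrite mulrC; apply: (idealMl b (il u ul)); apply: al.
Qed.

Lemma exists_critical_ideal : noetherian R ->
    (forall s : seq M, infinite_set (supp_over (span s))) ->
  exists I : set R,
    (forall s : seq M,
       infinite_set [set q | supp_over (span s) q /\ I `<=` [set` q]]) /\
    (forall J, ideal J -> I `<=` J -> ~ J `<=` I -> exists s : seq M,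
       finite_set [set q | supp_over (span s) q /\ J `<=` [set` q]]).
Proof.
move=> noeR infS.
pose F (I : set R) := ideal I /\ forall s : seq M,
  infinite_set [set q | supp_over (span s) q /\ I `<=` [set` q]].
have F0 : F [set 0].
  split=> [|s]; first by split=> // a _ _ -> ->; rewrite /= mulr0 addr0.
  apply: sub_infinite_set (infS s) => q sq; split=> // _ ->.
  by case: sq => -[[]].
have [I [iI infI] maxI] := noetherian_maximal noeR F0 (fun J => @proj1 _ _).
exists I; split=> // J iJ IJ nJI; apply: contrapT => noS; apply: nJI.
by apply: maxI => //; split=> // s finS; apply: noS; exists s.
Qed.

(* With [N = sum R y] and [K = sum q y] over the [(q, y)] in [l], the last
   clause makes [(N + R z.2) / (K + z.1 z.2)] the direct sum of [N / K] and
   [R / z.1]. *)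
Definition next_prime l z :=
  [/\ prime_ideal z.1,
      forall u, u \in l -> ~ [set` u.1] `<=` [set` z.1]
    & forall r, span [seq u.2 | u <- l] (r *: z.2) ->
        r \in z.1 /\ wspan l (r *: z.2)].

(* The witness is [y = a ^ (c + 1) x] where [a] lies in every earlier prime but
   not in [q], and [c] is such that [(L : a ^ c x)] is stationary. *)
Lemma exists_next_prime N l (q : pred R) x : noetherian R ->
    span [seq u.2 | u <- l] `<=` N -> prime_ideal q -> ideal_weights l ->
    (forall u, u \in l -> ~ [set` u.1] `<=` [set` q]) ->
    colon N x `<=` [set` q] ->
  exists y, next_prime l (q, y).
Proof.
move=> noeR lN pq il nq Nq; have [a aq al] := prime_avoid pq il nq.
set L := span _ in lN; have sL : submodule L := submodule_span _.
pose F (J : set R) := exists c, J = colon L (a ^+ c *: x).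
have F0 : F (colon L (a ^+ 0 *: x)) by exists 0%N.
have iF J : F J -> ideal J by move=> [c ->]; apply: ideal_colon.
have [_ [c ->] maxc] := noetherian_maximal noeR F0 iF.
(* [a] lies in every weight of [l], so it multiplies the full span into the weighted one. *)
have aL w : L w -> wspan l (a *: w).
  have sl := submodule_wspan il.
  apply: (@span_sub _ _ _ [set w | wspan l (a *: w)]) => [|y /mapP[u ul ->]].
    split=> [|b v w' lv lw]; first by rewrite /= scaler0; case: sl.
    rewrite /= scalerDr scalerA mulrC -scalerA; apply: submoduleD => //.
    exact: submoduleZ.
  exact: wspan_mem (al u ul).
exists (a ^+ c.+1 *: x); split=> //= r Lr; split.
  have /Nq : colon N x (r * a ^+ c.+1) by rewrite /colon /= -scalerA; apply: lN.
  move=> /(prime_idealM pq)/orP[//|/(prime_idealX pq)].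
  by rewrite (negPf aq).
have aE t : t *: (a ^+ c.+1 *: x) = a *: (t *: (a ^+ c *: x)).
  by rewrite exprS !scalerA mulrCA mulrA.
(* By stationarity [r (a ^ c x)] is already in [L]; one more factor [a] takes it into [wspan l]. *)
have : colon L (a ^+ c *: x) r.
  apply: (maxc (colon L (a ^+ c.+1 *: x))) Lr; first by exists c.+1.
  move=> t Lt; rewrite /colon /= aE.
  exact: submoduleZ.
by move=> /aL; rewrite aE.
Qed.

(** In the union of the weighted spans, the colon ideal of each [(z m).2] is exactly [(z m).1], and
    these primes are distinct because none contains an earlier one. *)
Lemma infinite_Ass_of_chain (z : nat -> pred R * M) :
    (forall n, next_prime [seq z i | i <- rev (iota 0 n)] (z n)) ->
  exists2 N : set M, submodule N & infinite_set (Ass_over N).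
Proof.
move=> zP; pose l n := [seq z i | i <- rev (iota 0 n)].
have lS n : l n.+1 = z n :: l n by rewrite /l -[n.+1]addn1 iotaD rev_cat.
have il n : ideal_weights (l n).
  by move=> _ /mapP[i _ ->]; apply: prime_is_ideal; case: (zP i).
have sl n : submodule (wspan (l n)) by apply: submodule_wspan.
have le_l m n : (m <= n)%N -> wspan (l m) `<=` wspan (l n).
  move=> /subnK <-; elim: (n - m)%N => //= k IHk; rewrite addSn lS.
  apply: subset_trans IHk _; apply: sub_add_line.
  by apply: prime_is_ideal; case: (zP (k + m)%N).
have l_span n : wspan (l n) `<=` span [seq u.2 | u <- l n].
  apply: wspan_sub (submodule_span _) _ => u ul a _.
  by apply: submoduleZ (submodule_span _) _; apply/span_mem/map_f.
have mem_l m n : (m < n)%N -> z m \in l n.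
  by move=> mn; apply: map_f; rewrite mem_rev mem_iota.
have span_l m n r : (m < n)%N -> span [seq u.2 | u <- l n] (r *: (z m).2).
  move=> mn; apply: submoduleZ (submodule_span _) _.
  by apply/span_mem/map_f/mem_l.
pose N : set M := \bigcup_n wspan (l n).
have sN : submodule N.
  split=> [|a x y [i _ xi] [j _ yj]]; first by exists 0%N.
  exists (maxn i j) => //; apply: submoduleD => //.
    by apply: submoduleZ => //; apply: (le_l _ _ (leq_maxl i j)).
  exact: (le_l _ _ (leq_maxr i j)).
have colon_z m n r : wspan (l n) (r *: (z m).2) -> r \in (z m).1.
  have [pz _ zmP] := zP m.
  elim: n => [|n IHn].
    move=> r0; apply: (zmP r _).1; rewrite r0.
    by case: (submodule_span [seq u.2 | u <- l m]).
  (* Up to stage [m + 1], [r - a] lies in the prime by the choice of [z m]. Later, the new term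
     [a *: (z n).2] lies in the span of the earlier elements, hence in [wspan (l n)], and induction
     applies. *)
  case: (ltnP m n) => [mn|nm]; last first.
    move=> /(le_l _ _ (_ : n.+1 <= m.+1)%N)-/(_ nm); rewrite lS.
    move=> [w [a [lw az rz]]].
    have /zmP[rap _] : span [seq u.2 | u <- l m] ((r - a) *: (z m).2).
      by rewrite scalerBl rz addrK; apply: l_span.
    rewrite -[r](subrK a).
    exact: (submoduleD (ideal_submodule (prime_is_ideal pz))).
  rewrite lS => -[w [a [lw az rz]]]; apply: IHn; rewrite rz.
  apply: submoduleD => //; have [_ _ znP] := zP n; apply: (znP a _).2.
  rewrite -[_ *: _](addKr w) -rz addrC.
  by apply: submoduleB (submodule_span _) _ _; [apply: span_l | apply: l_span].
exists N => //.
have z1_neq i j : (i < j)%N -> (z i).1 <> (z j).1.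
  move=> ij zij; have [_ nz _] := zP j; apply: (nz _ (mem_l _ _ ij)).
  by rewrite zij.
have z1_inj : injective (fun n => (z n).1).
  by move=> i j zij; case: (ltngtP i j) => // /z1_neq; rewrite zij.
have zN : range (fun n => (z n).1) `<=` Ass_over N.
  move=> _ [n _ <-]; have [pz _ _] := zP n; split=> //.
  exists (z n).2 => r; split=> [rz|[m _]]; last exact: colon_z.
  by exists n.+1 => //; apply: wspan_mem rz => //; apply: mem_l.
apply: sub_infinite_set zN _ => finz; apply: infinite_nat.
by rewrite -(eq_finite_set (inj_card_eq (in2W z1_inj))).
Qed.

Lemma exists_infinite_Ass : noetherian R ->
    (forall s : seq M, infinite_set (supp_over (span s))) ->
  exists2 N : set M, submodule N & infinite_set (Ass_over N).
Proof.
move=> noeR infS.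
have [I [infI finI]] := exists_critical_ideal noeR infS.
pose good z := [/\ prime_ideal z.1, I `<=` [set` z.1] & ~ [set` z.1] `<=` I].
(* For a prime strictly above [I], [t] picks generators modulo which only finitely many primes of
   the support contain it; elsewhere [[::]] is a dummy. *)
have /choice[t tP] : forall z, exists s : seq M, good z ->
    finite_set [set q | supp_over (span s) q /\ [set` z.1] `<=` [set` q]].
  move=> z; case: (pselect (good z)) => [[pz Iz nz]|]; last by exists [::].
  by have [s fs] := finI _ (prime_is_ideal pz) Iz nz; exists s.
have step l : exists z,
    (forall u, u \in l -> good u) -> good z /\ next_prime l z.
  case: (pselect (forall u, u \in l -> good u)) => [gl|]; last first.
    by exists (xpredT, 0).
  (* Including every [t u] shrinks the support, so a prime of it that contains some earlier [u.1]
     lies in the finite set [V u]. *)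
  pose s := [seq u.2 | u <- l] ++ flatten [seq t u | u <- l].
  pose V (u : pred R * M) :=
    [set q | supp_over (span (t u)) q /\ [set` u.1] `<=` [set` q]].
  (* [I] may itself be prime; excluding it keeps the new prime strictly above [I]. *)
  pose Ip : pred R := [pred x | `[< I x >]].
  pose bad : set (pred R) := [set Ip] `|` \bigcup_(u in [set` l]) V u.
  have fin_bad : finite_set bad.
    rewrite finite_setU; split; first exact: finite_set1.
    apply: bigcup_finite => [|u /gl/tP//].
    exact: finite_seq.
  have [q [[[pq [x xq]] Iq] nbad]] :=
    infinite_setN0 (infinite_setD (infI s) fin_bad).
  have nl u : u \in l -> ~ [set` u.1] `<=` [set` q].
    move=> ul uq; apply: nbad; right; exists u => //; split=> //.
    split=> //; exists x => r tr; apply: xq.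
    apply: (span_sub _ _ tr) => [|y yt]; first exact: submodule_span.
    apply: span_mem; rewrite mem_cat; apply/orP; right.
    by apply/flattenP; exists (t u) => //; apply: map_f.
  have il : ideal_weights l by move=> u /gl[/prime_is_ideal].
  have ls : span [seq u.2 | u <- l] `<=` span s.
    apply: span_sub (submodule_span _) _ => y yl.
    by apply: span_mem; rewrite mem_cat yl.
  have [y yP] := exists_next_prime noeR ls pq il nl xq.
  exists (q, y) => _; split=> //; split=> //= qI; apply: nbad; left.
  apply/funext => r; apply/idP/idP => [/qI Ir|/asboolP/Iq//].
  exact/asboolP.
have {step}[next nextP] := choice step.
pose ls := fix ls n := if n is n'.+1 then next (ls n') :: ls n' else [::].
pose z n := next (ls n).
have lsE n : ls n = [seq z i | i <- rev (iota 0 n)].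
  by elim: n => // n IHn; rewrite -[in RHS]addn1 iotaD rev_cat /= -IHn.
have gls n : forall u, u \in ls n -> good u.
  elim: n => //= n IHn u; rewrite inE => /orP[/eqP ->|/IHn//].
  by case: (nextP _ IHn).
apply: (@infinite_Ass_of_chain z) => n; rewrite -lsE.
by case: (nextP _ (gls n)).
Qed.

End InfiniteAss.

(** * Passage from [R]-submodules to [S]-submodules *)

Theorem theorem0p4 (R S : comNzRingType) (m : pred R) (n : pred S)
    (phi : {rmorphism R -> S})
    (noethR : noetherian R) (noethS : noetherian S)
    (locR : local_ring m) (locS : local_ring n)
    (loc_phi : local_hom m n phi)
    (fgS : finitely_generated (restr_scalars phi S^o))
    (M : lmodType S) (wlM : weakly_laskerian M) :
  weakly_laskerian (restr_scalars phi M).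
Proof.
move=> N _; rewrite Ass_quotmod; apply: contrapT => infN.
have sN : submodule [set` N].
  split=> [|a x y Nx Ny] /=; first exact: rpred0.
  by apply: rpredD => //; apply: rpredZ.
have [] := @exists_infinite_Ass S M noethS; last first.
  move=> K sK infK; pose Kp : pred M := [pred x | `[< K x >]].
  have KpP x : x \in Kp <-> K x by split=> [/asboolP|?]//; apply/asboolP.
  have Kpsub : GRing.subsemimod_closed Kp.
    split; first split.
    - by apply/KpP; case: sK.
    - by move=> x y /KpP Kx /KpP Ky; apply/KpP/(submoduleD sK).
    - by move=> a x /KpP Kx; apply/KpP/(submoduleZ a sK).
  pose KM := GRing.isSubmodClosed.Build S M Kp Kpsub.
  pose KC : submodClosed M := HB.pack Kp KM.
  have KE : [set` KC] = K by apply/seteqP; split=> x /KpP.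
  (* Any associated prime [P = (K : x)] shows that [K] is proper: 1 is not in [P], so [x] is not in
     [K]. *)
  have [P [pP [x Px]]] := infinite_setN0 infK.
  apply: infK; rewrite -KE -Ass_quotmod; apply: wlM; exists x.
  apply/negP => /KpP Kx; move/negP: (prime_ideal1 pP); apply; apply/Px.
  by rewrite scale1r.
move=> s finS; have [k [g gP]] := fgS.
(* Over [R], these products generate the [S]-span of [s]. *)
pose s' : seq (restr_scalars phi M) := [seq g i *: y | i <- enum 'I_k, y <- s].
have [N' [sN' infN'] [NN' s'N']] : exists2 N' : set (restr_scalars phi M),
    submodule N' /\ infinite_set (Ass_over N') &
    [set` N] `<=` N' /\ forall y, y \in s' -> N' y.
  elim: s' => [|y s' [N' [sN' infN'] [NN' s'N']]].
    by exists [set` N]; split=> //; apply: subset_refl.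
  exists (add_line N' setT y); split.
  - exact: submodule_add_line.
  - exact: infinite_Ass_over_add_line.
  - exact: subset_trans NN' (sub_add_line _ (@idealT R)).
  - move=> w; rewrite inE => /orP[/eqP ->|/s'N' N'w]; last exact: sub_add_line.
    by exists 0, 1; rewrite add0r scale1r; split=> //; case: sN'.
have spanN' w : span s w -> N' w.
  (* [N'] is only an [R]-submodule, but the elements all of whose [S]-multiples lie in it form an
     [S]-submodule. *)
  suff sub : span s `<=` [set w | forall a : S, N' (a *: w)].
    by move=> /sub/(_ 1); rewrite scale1r.
  apply: span_sub => [|y ys a /=].
    split=> [a|b u v Nu Nv a]; first by rewrite scaler0; case: sN'.
    by rewrite scalerDr scalerA; apply: (submoduleD sN').
  have [c ->] := gP a; rewrite scaler_suml; apply: (submodule_sum _ sN') => i.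
  rewrite -[X in N' X]scalerA; apply: (submoduleZ (c i) sN').
  by apply/s'N'/allpairsP; exists (i, y); split=> //; rewrite mem_enum.
pose contract (q : pred S) : pred R := [pred r | phi r \in q].
(* Each [p = (N' : x)] contains the contraction of [(span s : x)], so lying over makes it the
   contraction of a prime in the support assumed finite. *)
apply: infN'; apply: sub_finite_set (finite_image contract finS).
move=> p [pp [x px]].
have ix := @ideal_colon S M _ x (submodule_span s).
have [|q [pq xq qp]] := lying_over noethS fgS ix pp.
  by move=> r /spanN'/px.
exists q; first by split=> //; exists x.
by apply/funext => r; apply/idP/idP => /qp.
Qed.
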